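(* Let $s \geq 0$, $\tilde r > 0$, $M = sI + \tilde r K_n$, $r = s + \tilde r$ and $\mu = \tilde r / r \in (0,1]$, where $K_n \in \mathbb{C}^{n\times n}$ ($n \geq 2$) has as its field of values the closed unit disk. Let $\phi_j \in (0,\pi)$ and let $\{\phi_k\}_{k\geq j}$ be the sequence of angles produced by Uhlig's cutting procedure applied sequentially to the clockwise corners $\{c_k\}_{k \geq j}$ (as described in the context), which satisfies $\phi_{k+1} = \arctan(\mu \tan \tfrac12\phi_k)$ for all $k \ge j$. Then the corresponding sequence $\{|c_k|\}$ converges to $r$ Q-linearly with rate $\tfrac14 \mu^2$.
   Context: The field of values of $A\in\mathbb{C}^{n\times n}$ is $W(A) = \{x^*Ax : \|x\|=1\}$ and its numerical radius is $r(A) = \max\{|z| : z \in W(A)\}$. For an angle $\theta$, $L_\theta$ denotes the supporting line $\{e^{-\mathbf{i}\theta}(\lambda_\theta + \mathbf{i}t): t \in \mathbb{R}\}$ of $W(M)$, where $\lambda_\theta$ is the largest eigenvalue of $\tfrac12(e^{\mathbf{i}\theta}M + e^{-\mathbf{i}\theta}M^* )$. $W(M)$ is the closed disk of radius $\tilde r$ centered at $s$ on the real axis, with outermost point $b_\star = s + \tilde r = r = r(M)$. The line $L_0$ is the vertical tangent to $W(M)$ at $b_\star$. For $\phi \in (0,\pi)$, the line $L_{-\phi}$ is the tangent to $W(M)$ at the boundary point $s + \tilde r e^{\mathbf{i}\phi}$. Sequence of clockwise corners: start from the boundary point $b_j = s + \tilde r e^{\mathbf{i}\phi_j}$ with $\phi_j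 = \operatorname{Arg}(b_j - s) \in (0,\pi)$. For $k \geq j$, given the boundary point $b_k = s + \tilde r e^{\mathbf{i}\phi_k}$, let $c_k = L_0 \cap L_{-\phi_k}$ be the corner of the polygonal outer approximation lying between $b_\star$ and $b_k$. Uhlig's cut of $c_k$ uses the supporting line $L_{\theta_{k+1}}$ with $\theta_{k+1} = -\operatorname{Arg}(c_k)$, giving the new boundary point $b_{k+1}$ of $W(M)$ on $L_{\theta_{k+1}}$, and $\phi_{k+1} = \operatorname{Arg}(b_{k+1} - s)$. The next corner to be cut is $c_{k+1} = L_0 \cap L_{\theta_{k+1}}$, and so on. A sequence $\{x_k\}$ with $x_k \neq x_\star$ converges to $x_\star$ Q-linearly with rate $q \in (0,1)$ if $x_k \to x_\star$ and $\lim_{k\to\infty} |x_{k+1} - x_\star|/|x_k - x_\star| = q$. *)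

(* Defs.v *)
From HB Require Import structures.
From mathcomp Require Import all_boot all_order all_algebra.
From mathcomp Require Import complex.
From mathcomp Require Import all_classical all_reals all_analysis.
Set Implicit Arguments.
Unset Strict Implicit.
Unset Printing Implicit Defensive.
Import Order.TTheory GRing.Theory Num.Theory.
Import numFieldNormedType.Exports.
Import ComplexField.Normc.
Local Open Scope complex_scope.
Local Open Scope sesquilinear_scope.
Local Open Scope classical_set_scope.
Local Open Scope ring_scope.

Section Defs.
Variable R : realType.
Local Notation C := R[i].

Definition expi (t : R) : C := cos t +i* sin t.

(* Principal argument in ]-pi, pi]; Arg 0 = 0 by convention. *)
Definition Arg (z : C) : R :=
  if z == 0 then 0
  else if 0 <= complex.Im z then acos (complex.Re z / normc z)
  else - acos (complex.Re z / normc z).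

(* R[i] carries its metric topology through its regular-module alias R[i]^o. *)
Definition boundary (A : set C) : set C :=
  closure (A : set C^o) `\` interior (A : set C^o).

Definition field_of_values n (A : 'M[C]_n) : set C :=
  [set z | exists2 x : 'cV[C]_n,
     sqrtC (\sum_i `|x i 0| ^+ 2) = 1 & z = (x^t* *m A *m x) 0 0].

Definition rot_herm n (M : 'M[C]_n) (theta : R) : 'M[C]_n :=
  2^-1 *: (expi theta *: M + expi (- theta) *: M^t*).

(* The order of R[i] is partial, x <= y meaning Im x = Im y and Re x <= Re y:
   every eigenvalue is thereby required to be real and at most l. *)
Definition largest_eigenvalue n (A : 'M[C]_n) (l : R) : Prop :=
  eigenvalue A l%:C /\ forall a : C, eigenvalue A a -> a <= l%:C.

Definition supporting_line n (M : 'M[C]_n) (theta : R) : set C :=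
  [set z | exists2 l : R, largest_eigenvalue (rot_herm M theta) l &
     exists t : R, z = expi (- theta) * (l +i* t)].

(* Uhlig's cutting procedure on the clockwise corners, run from index j on,
   for a matrix M whose field of values is the disk of center s and radius rt. *)
Record uhlig_clockwise_cuts n (M : 'M[C]_n) (s rt : R) (j : nat)
    (theta phi : nat -> R) (b c : nat -> C) : Prop := {
  start_point : b j = s%:C + rt%:C * expi (phi j) ;
  start_angle : 0 < phi j < pi ;
  corner : forall k, (j <= k)%N ->
    supporting_line M 0 `&` supporting_line M (- phi k) = [set c k] ;
  cut_angle : forall k, (j <= k)%N -> theta k.+1 = - Arg (c k) ;
  cut_point : forall k, (j <= k)%N ->
    boundary (field_of_values M) `&` supporting_line M (theta k.+1)
      = [set b k.+1] ;
  next_angle : forall k, (j <= k)%N -> phi k.+1 = Arg (b k.+1 - s%:C)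
}.

Definition Qlinear_cvg (x : nat -> R) (l q : R) : Prop :=
  [/\ 0 < q < 1, forall k, x k != l, x @ \oo --> l
    & (fun k => `|x k.+1 - l| / `|x k - l|) @ \oo --> q].

End Defs.

(* Main.v *)
(* The largest eigenvalue of the Hermitian part of e^{it} M is the maximum of
   Re (e^{it} z) over the field of values, so for the disk of center s and
   radius rt the supporting lines are its tangent lines. Hence
   c_k = r + i rt T_k with T_k = tan (phi_k / 2), and cutting c_k rotates the
   tangency angle to Arg c_k = atan (mu T_k). The double-angle formula turns this
   into T_{k+1} = mu T_k (1 - T_{k+1}^2) / 2, so T_k -> 0 and T_{k+1} / T_k tends
   to mu / 2. Since |c_k| - r = (rt T_k)^2 / (|c_k| + r), the rate of |c_k| is the
   square of that limit. *)

Require Import Defs.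
From HB Require Import structures.
From mathcomp Require Import all_boot all_order all_algebra.
From mathcomp Require Import complex.
From mathcomp Require Import all_classical all_reals all_analysis.
From mathcomp Require Import ring lra.
Import Order.TTheory GRing.Theory Num.Theory.
Import numFieldNormedType.Exports.
Import ComplexField.Normc.
Local Open Scope complex_scope.
Local Open Scope classical_set_scope.
Local Open Scope ring_scope.

(** * Quadratic forms and positive semidefinite matrices *)

Section QuadraticForm.
Local Open Scope sesquilinear_scope.
Context {C : numClosedFieldType} {n : nat}.
Implicit Types (A : 'M[C]_n) (x y : 'cV[C]_n).

Definition qform A x : C := (x^t* *m A *m x) 0 0.

Lemma trmxC_mul m p q (A : 'M[C]_(m, p)) (B : 'M[C]_(p, q)) :
  (A *m B)^t* = B^t* *m A^t*.
Proof. by rewrite trmx_mul map_mxM. Qed.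

Lemma trmxCZ m p (a : C) (A : 'M[C]_(m, p)) : (a *: A)^t* = a^* *: A^t*.
Proof. by apply/matrixP => i k; rewrite !mxE rmorphM. Qed.

Lemma trmxCD m p (A B : 'M[C]_(m, p)) : (A + B)^t* = A^t* + B^t*.
Proof. by apply/matrixP => i k; rewrite !mxE rmorphD. Qed.

Lemma trmxCB m p (A B : 'M[C]_(m, p)) : (A - B)^t* = A^t* - B^t*.
Proof. by apply/matrixP => i k; rewrite !mxE rmorphB. Qed.

Lemma trmxC1 m : (1%:M : 'M[C]_m)^t* = 1%:M.
Proof. by rewrite trmx1 map_mx1. Qed.

Lemma qformD A B x : qform (A + B) x = qform A x + qform B x.
Proof. by rewrite /qform mulmxDr mulmxDl mxE. Qed.

Lemma qformZ (a : C) A x : qform (a *: A) x = a * qform A x.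
Proof. by rewrite /qform -scalemxAr -scalemxAl mxE. Qed.

Lemma qform_scalev (a : C) A x : qform A (a *: x) = `|a| ^+ 2 * qform A x.
Proof.
rewrite /qform trmxCZ -!scalemxAl -!scalemxAr mxE mxE.
by rewrite mulrA [_ * a]mulrC -normCK.
Qed.

Lemma qform_trmxC A x : qform (A^t* ) x = (qform A x)^*.
Proof.
rewrite /qform.
have -> : x^t* *m A^t* *m x = (x^t* *m A *m x)^t*.
  by rewrite !trmxC_mul trmxCK mulmxA.
by rewrite mxE mxE.
Qed.

Lemma qform1 x : qform 1%:M x = \sum_i `|x i 0| ^+ 2.
Proof.
rewrite /qform mulmx1 mxE; apply: eq_bigr => i _.
by rewrite !mxE normCK mulrC.
Qed.

Lemma qform1_ge0 x : 0 <= qform 1%:M x.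
Proof. by rewrite qform1 sumr_ge0 // => i _; rewrite exprn_ge0. Qed.

Lemma qform1_eq0 x : qform 1%:M x = 0 -> x = 0.
Proof.
rewrite qform1 => /eqP; rewrite psumr_eq0 => [/allP x0|i _]; last exact: exprn_ge0.
apply/colP => i; rewrite mxE; apply/eqP.
by have := x0 i (mem_index_enum i); rewrite /= expf_eq0 /= normr_eq0.
Qed.

(* With y = A x and a > 0 small, the form at x - a y is a |y|^2 (-2 + O(a)),
   which is nonnegative only if y = 0. *)
Lemma psd_qform_eq0 A x : A^t* = A -> (forall y, 0 <= qform A y) ->
  qform A x = 0 -> A *m x = 0.
Proof.
move=> Aherm Apsd Ax0; set y := A *m x.
set q := qform 1%:M y; set B := qform A y.
have q0 : 0 <= q by exact: qform1_ge0.
have B0 : 0 <= B by exact: Apsd.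
have expand (a : C) : a^* = a -> qform A (x - a *: y) = - (2 * a * q) + a ^+ 2 * B.
  move=> areal.
  have xAy : (x^t* *m A *m y) 0 0 = q.
    by rewrite /q /qform mulmx1 /y trmxC_mul Aherm.
  have yAx : (y^t* *m A *m x) 0 0 = q.
    by rewrite /q /qform mulmx1 /y !mulmxA.
  have entryB (u v : 'M[C]_1) : (u - v) 0 0 = u 0 0 - v 0 0 by rewrite !mxE.
  have entryZ (e : C) (u : 'M[C]_1) : (e *: u) 0 0 = e * u 0 0 by rewrite mxE.
  rewrite /qform trmxCB trmxCZ areal.
  rewrite !mulmxBl !mulmxBr -!scalemxAl -!scalemxAr !(entryB, entryZ) xAy yAx.
  rewrite -[_ 0 0]/(qform A x) Ax0 -/(qform A y) -/B; ring.
have B1 : 0 < B + 1 by rewrite ltr_wpDl.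
(* The coefficient nearly minimizes [- 2 a q + a^2 B]; the [+ 1] keeps the denominator positive when
   [B = 0]. *)
have : 0 <= qform A (x - (q / (B + 1)) *: y) by exact: Apsd.
rewrite expand; last first.
  by apply: CrealP; rewrite rpredM ?rpredV ?ger0_real // ltW.
have -> : - (2 * (q / (B + 1)) * q) + (q / (B + 1)) ^+ 2 * B
  = - (q ^+ 2 * (B + 2) / (B + 1) ^+ 2).
  by field; rewrite gt_eqF.
rewrite oppr_ge0 => le0; apply: qform1_eq0; apply/eqP; rewrite -/q.
have B2 : 0 < B + 2 by rewrite ltr_wpDl.
move: le0; rewrite pmulr_lle0 ?invr_gt0 ?exprn_gt0// pmulr_lle0// => le0.
by rewrite -sqrf_eq0 eq_le le0 exprn_ge0.
Qed.

End QuadraticForm.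

(** * Largest eigenvalue of the rotated Hermitian part *)

Section LargestEigenvalue.
Local Open Scope sesquilinear_scope.
Variable R : realType.
Local Notation C := R[i].

Lemma field_of_valuesE n (A : 'M[C]_n) :
  field_of_values A = [set z | exists2 x, qform 1%:M x = 1 & z = qform A x].
Proof.
apply/seteqP; split => z [x x1 ->]; exists x => //.
- by rewrite qform1 -[LHS]sqrtCK x1 expr1n.
- by rewrite -qform1 x1 sqrtC1.
Qed.

Lemma expiN (t : R) : expi (- t) = (expi t)^*%C.
Proof. by rewrite /expi cosN sinN. Qed.

(** The adjoint has the conjugate form value, so averaging leaves the real part. This ties the
    eigenvalues of [rot_herm M t] to the extent of the field of values in one direction. *)
Lemma qform_rot_herm n (M : 'M[C]_n) t (x : 'cV[C]_n) :
  qform (rot_herm M t) x = (complex.Re (expi t * qform M x))%:C.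
Proof.
rewrite /rot_herm qformZ qformD !qformZ qform_trmxC ReJ_add expiN rmorphM /=.
by rewrite mulrC.
Qed.

Lemma rot_herm_trmxC n (M : 'M[C]_n) t : (rot_herm M t)^t* = rot_herm M t.
Proof.
rewrite /rot_herm trmxCZ trmxCD !trmxCZ trmxCK [X in _ *: X]addrC; congr (_ *: (_ + _)).
- by rewrite fmorphV rmorph_nat.
- by congr (_ *: _); rewrite expiN; exact: conjcK.
- by congr (_ *: _); rewrite expiN.
Qed.

(** Rayleigh argument: the bound [m] makes [m I - H] positive semidefinite, and its form vanishes at
    a unit vector attaining [m]. That vector lies in the kernel, so [m] is an eigenvalue and
    [m <= l]; the Rayleigh quotient of an eigenvector for [l] gives [l <= m]. *)
Lemma largest_eigenvalue_rot_herm n (M : 'M[C]_n) (t l m : R) :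
  (forall z, field_of_values M z -> complex.Re (expi t * z) <= m) ->
  (exists2 z, field_of_values M z & complex.Re (expi t * z) = m) ->
  largest_eigenvalue (rot_herm M t) l -> l = m.
Proof.
move=> ub [z0 + z0m] [/eigenvalueP[v vl v0] lmax].
set H := rot_herm M t in vl lmax *.
rewrite field_of_valuesE => -[x0 x01 z0E].
have Hle x : qform H x <= m%:C * qform 1%:M x.
  have [->|x_neq0] := eqVneq x 0; first by rewrite /qform !mulmx0 mxE mulr0.
  set N := qform 1%:M x.
  have N0 : 0 < N.
    rewrite lt_neqAle qform1_ge0 andbT eq_sym.
    by apply: contra x_neq0 => /eqP/qform1_eq0 ->.
  pose a := (sqrtC N)^-1.
  have a2 : `|a| ^+ 2 = N^-1.
    by rewrite normfV exprVn ger0_norm ?sqrtC_ge0 ?ltW// sqrtCK.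
  have x1 : qform 1%:M (a *: x) = 1.
    by rewrite qform_scalev a2 mulVf // gt_eqF.
  have : qform H (a *: x) <= m%:C.
    rewrite /H qform_rot_herm lecR; apply: ub.
    by rewrite field_of_valuesE; exists (a *: x).
  by rewrite qform_scalev a2 mulrC ler_pdivrMr.
have Hx0 : qform H x0 = m%:C by rewrite /H qform_rot_herm -z0E z0m.
pose P := m%:C *: 1%:M - H.
have qP x : qform P x = m%:C * qform 1%:M x - qform H x.
  by rewrite /P qformD qformZ -scaleN1r qformZ mulN1r.
have Px0 : P *m x0 = 0.
  apply: psd_qform_eq0 => [|y|].
  - rewrite /P trmxCB trmxCZ rot_herm_trmxC trmxC1.
    by congr (_ *: _ - _); exact: conjc_real.
  - by rewrite qP subr_ge0.
  - by rewrite qP x01 mulr1 Hx0 subrr.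
apply/eqP; rewrite eq_le -!lecR; apply/andP; split.
(* [eigenvalue] speaks of row eigenvectors, so the form is evaluated at the adjoint of [v];
   conversely the adjoint of [x0] serves as the row eigenvector for [m]. *)
- have vt0 : 0 < qform 1%:M (v^t* ).
    rewrite lt_neqAle qform1_ge0 andbT eq_sym.
    by apply: contra v0 => /eqP/qform1_eq0 vt0; rewrite -[v]trmxCK vt0 trmx0 map_mx0.
  have := Hle (v^t* ).
  rewrite {1}/qform trmxCK vl -scalemxAl mxE.
  rewrite -[(v *m _) 0 0]/((v *m v^t*) 0 0).
  have -> : (v *m v^t*) 0 0 = qform 1%:M (v^t* ) by rewrite /qform trmxCK mulmx1.
  by rewrite ler_pM2r.
- apply: lmax; apply/eigenvalueP; exists (x0^t* ).
  + have := congr1 (fun X => X^t*) Px0; rewrite trmxC_mul trmx0 map_mx0 /P.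
    rewrite trmxCB trmxCZ rot_herm_trmxC trmxC1.
    rewrite mulmxBr -scalemxAr mulmx1 => /eqP; rewrite subr_eq0 => /eqP <-.
    by congr (_ *: _); exact: conjc_real.
  + apply/eqP => x00; move: x01; rewrite /qform x00 !mul0mx mxE => /esym/eqP.
    by rewrite oner_eq0.
Qed.

End LargestEigenvalue.

(** * Tangent lines, tangency points and corners of a disk *)

Section Disk.
Context {R : realType}.
Local Notation C := R[i].

Lemma expi_mulN (t : R) : expi t * expi (- t) = 1 :> C.
Proof.
rewrite /expi cosN sinN; apply/eqP; rewrite eq_complex /=; apply/andP; split; apply/eqP.
  by rewrite mulrN opprK -!expr2 cos2Dsin2.
by ring.
Qed.

Lemma norm_expi (t : R) : `|expi t : C| = 1.
Proof. by rewrite normc_def /= cos2Dsin2 sqrtr1. Qed.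

Lemma Re_ler_norm (z : C) (a : R) : `|z| <= a%:C -> complex.Re z <= a.
Proof.
rewrite -lecR; apply: le_trans; apply: le_trans (normc_ge_Re z).
by rewrite lecR ler_norm.
Qed.

(** Once the real part uses up the whole modulus bound, the square of the imaginary part is at most
    0. This is what makes a tangency point unique. *)
Lemma norm_Re_eq (z : C) (a : R) : `|z| <= a%:C -> complex.Re z = a -> z = a%:C.
Proof.
case: z => x y /[swap] /= -> le_a.
have a0 : 0 <= a by rewrite -lecR (le_trans (normr_ge0 _) le_a).
move: le_a; rewrite normc_def /= lecR -[leRHS](ger0_norm a0) -sqrtr_sqr.
rewrite ler_sqrt ?sqr_ge0// gerDl => y2.
have /eqP : y ^+ 2 = 0 by apply/eqP; rewrite eq_le y2 sqr_ge0.
by rewrite sqrf_eq0 => /eqP ->.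
Qed.

(** A point at distance [d > a] from [s] is the center of a ball of radius [d - a] that misses the
    disk, hence misses [A]. *)
Lemma closure_disk (A : set C) (s : C) (a : R) :
  A `<=` [set z | `|z - s| <= a%:C] ->
  closure (A : set C^o) `<=` [set z : C | `|z - s| <= a%:C].
Proof.
move=> Aa b clb /=; rewrite normc_def lecR leNgt; apply/negP => lt_ab.
set d := Num.sqrt _ in lt_ab.
have e0 : 0 < ((d - a)%:C : C) by rewrite ltcR subr_gt0.
have [z [/Aa /= za]] := clb _ (nbhsx_ballx (b : C^o) _ e0).
rewrite -ball_normE /= => bz.
have : `|b - s| < d%:C.
  rewrite -(subrKA z) (le_lt_trans (ler_normD _ _))//.
  by rewrite (_ : d%:C = (d - a)%:C + a%:C) ?ltr_leD// -rmorphD subrK.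
by rewrite normc_def ltxx.
Qed.

Section DiskMatrix.
Context {n : nat} (K M : 'M[C]_n) (s rt : R).
Hypothesis W_K : field_of_values K = [set z : C | `|z| <= 1].
Hypothesis rt_ge0 : 0 <= rt.
Hypothesis ME : M = (s%:C)%:M + rt%:C *: K.

Lemma field_of_values_disk :
  field_of_values M = [set z : C | `|z - s%:C| <= rt%:C].
Proof.
have qM x : qform 1%:M x = 1 -> qform M x = s%:C + rt%:C * qform K x.
  by move=> x1; rewrite ME qformD qformZ -scalemx1 qformZ x1 mulr1.
have rtc0 : 0 <= (rt%:C : C) by rewrite ler0c.
apply/seteqP; split => z.
- rewrite field_of_valuesE => -[x x1 ->] /=; rewrite qM // addrC addKr.
  have /= Kx : [set z : C | `|z| <= 1] (qform K x).
    by rewrite -W_K field_of_valuesE; exists x.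
  by rewrite normrM (ger0_norm rtc0) ler_piMr.
- move=> /= zrt.
  (* For [rt = 0] rescaling would divide by 0; the disk is then the point [s], and any unit vector
     will do. One comes from 0 being in the field of values of [K]. *)
  have [rt0|rt_neq0] := eqVneq rt 0.
    have zs : z = s%:C.
      by apply/eqP; rewrite -subr_eq0 -normr_le0 (le_trans zrt)// rt0.
    have : [set z : C | `|z| <= 1] 0 by rewrite /= normr0.
    rewrite -W_K !field_of_valuesE => -[x x1 _]; exists x => //.
    by rewrite qM // rt0 mul0r addr0.
  have rtc_gt0 : 0 < (rt%:C : C) by rewrite ltcR lt_neqAle eq_sym rt_neq0.
  have : [set z : C | `|z| <= 1] ((z - s%:C) / rt%:C).
    by rewrite /= normrM normfV (ger0_norm rtc0) ler_pdivrMr// mul1r.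
  rewrite -W_K !field_of_valuesE => -[x x1 zE]; exists x => //.
  by rewrite qM // -zE mulrC divfK ?gt_eqF// addrC subrK.
Qed.

(** The support function of the disk in direction [expi (- t)] is [s cos t + rt], which identifies
    [l]; subtracting the contribution of the center leaves [rt]. *)
Lemma supporting_line_disk t z :
  supporting_line M t z -> complex.Re (expi t * (z - s%:C)) = rt.
Proof.
case=> l lM [u ->].
have Re_s (a : C) : complex.Re (expi t * (a - s%:C)) = complex.Re (expi t * a) - s * cos t.
  by case: a => x y; rewrite /expi /=; ring.
have -> : complex.Re (expi t * (expi (- t) * (l +i* u) - s%:C)) = l - s * cos t.
  by rewrite Re_s mulrA expi_mulN mul1r.
suff -> : l = s * cos t + rt by rewrite addrC addKr.
apply: largest_eigenvalue_rot_herm lM => [w|]; rewrite field_of_values_disk /=.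
- rewrite -lerBlDl -Re_s => ws; apply: Re_ler_norm.
  by rewrite normrM norm_expi mul1r.
(* The maximum is attained at the boundary point in the outward normal direction. *)
- exists (s%:C + rt%:C * expi (- t)).
    rewrite /= addrC addKr normrM norm_expi mulr1 ger0_norm// ler0c//.
  apply/eqP; rewrite -subr_eq0 opprD addrA -Re_s (addrC s%:C) addrK mulrCA expi_mulN mulr1.
  by rewrite /= subrr.
Qed.

(** After rotation, [z - s] has modulus at most [rt] and real part [rt], so the equality case
    applies. *)
Lemma support_point_disk t z :
  (boundary (field_of_values M) `&` supporting_line M t) z ->
  z = s%:C + rt%:C * expi (- t).
Proof.
move=> [[clz _] /supporting_line_disk zt].
have zs : `|z - s%:C| <= rt%:C.
  by apply: closure_disk clz; rewrite field_of_values_disk.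
have : expi t * (z - s%:C) = rt%:C.
  by apply: norm_Re_eq zt; rewrite normrM norm_expi mul1r.
by move=> <-; rewrite mulrAC expi_mulN mul1r addrC subrK.
Qed.

Lemma corner_disk phi z : 0 < phi < pi ->
  (supporting_line M 0 `&` supporting_line M (- phi)) z ->
  z = (s + rt) +i* (rt * tan (phi / 2)).
Proof.
move=> /andP[phi0 phipi] [/supporting_line_disk + /supporting_line_disk].
case: z => x y; rewrite /expi /= cosN sinN cos0 sin0 => hx.
have {hx} -> : x = s + rt by rewrite -{}hx; ring.
have [h0 hpi] : 0 < phi / 2 /\ phi / 2 < pi / 2 by split; lra.
have ch : 0 < cos (phi / 2).
  by apply: cos_gt0_pihalf; rewrite hpi andbT (lt_trans _ h0)// oppr_lt0 divr_gt0 ?pi_gt0.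
have sh : 0 < sin (phi / 2) by apply: sin_gt0_pi; rewrite h0/=; have := pi_gt0 R; lra.
set h := phi / 2 in h0 hpi ch sh *.
have -> : phi = h *+ 2 by rewrite -mulr_natr divfK.
rewrite cos_mulr2n sin_mulr2n => hy.
(* With [phi = 2 h], the second tangent equation reads [y sin h cos h = rt (sin h)^2]; both factors
   on the left of [rt] are positive and may be cancelled. *)
congr (_ +i* _); apply: (mulIf (lt0r_neq0 ch)); apply: (mulIf (lt0r_neq0 sh)).
rewrite /tan mulrA divfK ?lt0r_neq0//.
have := cos2Dsin2 h; move: (cos h) (sin h) hy => u v hy uv.
have {uv} -> : rt * v * v = rt * (1 - u ^+ 2) by rewrite -uv; ring.
lra.
Qed.

End DiskMatrix.

End Disk.

(** * Arguments in the upper half-plane and the half-angle tangent *)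

Lemma Arg_polar {R : realType} (a t : R) : 0 < a -> 0 <= t <= pi ->
  Arg (a%:C * expi t) = t.
Proof.
move=> a0 t0pi; rewrite /Arg /=.
have sin0 : 0 <= sin t by exact: sin_ge0_pi.
have -> : (a%:C * expi t == 0) = false.
  by rewrite -normr_eq0 normrM norm_expi mulr1 normr_eq0 eq_complex /= gt_eqF.
have -> : a * cos t - 0 * sin t = a * cos t by ring.
have -> : a * sin t + 0 * cos t = a * sin t by ring.
have -> : (a * cos t) ^+ 2 + (a * sin t) ^+ 2 = a ^+ 2.
  by rewrite !exprMn -mulrDr cos2Dsin2 mulr1.
rewrite mulr_ge0 ?(ltW a0)// sqrtr_sqr gtr0_norm// mulrAC divff ?gt_eqF// mul1r.
by rewrite cosK// in_itv.
Qed.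

Lemma Arg_right {R : realType} (x y : R) : 0 < x -> 0 <= y ->
  Arg (x +i* y) = atan (y / x).
Proof.
move=> x0 y0; set t := atan (y / x).
have ct : 0 < cos t by rewrite cos_gt0_pihalf// atan_gtNpi2 atan_ltpi2.
have t0 : 0 <= t by rewrite -[leLHS]atan0 le_atan// divr_ge0// ltW.
(* Polar form with modulus [x / cos t], which turns the claim into [Arg_polar]. *)
have -> : x +i* y = (x / cos t)%:C * expi t.
  have yE : y = x * (sin t / cos t) by rewrite -/(tan t) atanK mulrC divfK ?gt_eqF.
  rewrite /expi; congr (_ +i* _); rewrite mul0r ?subr0 ?addr0 ?divfK ?gt_eqF//.
  by rewrite mulrAC -mulrA.
apply: Arg_polar; first exact: divr_gt0.
have := pi_gt0 R; have := atan_ltpi2 (y / x); rewrite -/t t0/=; lra.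
Qed.

(** The double-angle formula [x = 2 T / (1 - T^2)] is solved for the linear [T], leaving an implicit
    equation without square roots. The bound [T < 1] holds because half an arctangent stays below
    [pi / 4]. *)
Lemma tan_half_atan {R : realType} (x : R) : 0 < x ->
  let T := tan (atan x / 2) in
  0 < T < 1 /\ T = x * (1 - T ^+ 2) / 2.
Proof.
move=> x0 T; have p0 := pi_gt0 R.
have a0 : 0 < atan x by rewrite -[ltLHS]atan0 lt_atan.
have ap := atan_ltpi2 x.
have in_pi y : - (pi / 2) < y < pi / 2 -> y \in `](- (pi/2) : R), (pi/2)[.
  by rewrite in_itv.
have h0 : atan x / 2 \in `](- (pi/2) : R), (pi/2)[ by rewrite in_itv/=; lra.
have T0 : 0 < T by rewrite -[ltLHS]tan0 ltr_tan ?in_itv/=; lra.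
have T1 : T < 1 by rewrite -[ltRHS]tan_piquarter ltr_tan ?in_itv/=; lra.
have ch : cos (atan x / 2) != 0.
  by rewrite gt_eqF// cos_gt0_pihalf//; move: h0; rewrite in_itv.
have := tan_mulr2n ch; have -> : (atan x / 2) *+ 2 = atan x by rewrite -mulr_natr divfK.
rewrite atanK -/T => xE.
have T2 : 1 - T ^+ 2 != 0 by rewrite gt_eqF// subr_gt0 expr_lt1// ltW.
by split; [rewrite T0 | rewrite xE -mulr_natr; field].
Qed.

(** * Rate of convergence from the recurrence on half-angle tangents *)

Lemma Qlinear_cvg_hypot {R : realType} (r rt mu : R) (T : nat -> R) :
  0 < r -> 0 < rt -> 0 < mu <= 1 ->
  (forall k, 0 < T k) -> (forall k, T k.+1 < 1) ->
  (forall k, T k.+1 = mu * T k * (1 - T k.+1 ^+ 2) / 2) ->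
  Qlinear_cvg (fun k => Num.sqrt (r ^+ 2 + (rt * T k) ^+ 2)) r (mu ^+ 2 / 4).
Proof.
move=> r0 rt0 /andP[mu0 mu1] T0 T1 TS.
set x := fun k => _.
have cvg_sqr (u : nat -> R) (a : R) :
    u @ \oo --> a -> u k ^+ 2 @[k --> \oo] --> a ^+ 2.
  by move=> ua; exact: cvgM.
have T_cvg0 : T @ \oo --> 0.
  (* Since [mu] and [1 - T_{k+1}^2] lie in [[0, 1]], each step at least halves [T]. The bound by 1
     concerns only later terms: [T 0] may be large, as the starting angle may be close to [pi]. *)
  have T_le k : T k <= geometric (T 0) (1 / 2) k.
    elim: k => [|k IHk]; first by rewrite /geometric /= expr0 mulr1.
    rewrite /geometric /= exprS mulrCA; apply: (@le_trans _ _ (T k / 2)); last first.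
      by rewrite mulrC div1r ler_pM2l ?invr_gt0// -div1r.
    rewrite TS ler_pM2r ?invr_gt0//.
    have q1 : 1 - T k.+1 ^+ 2 <= 1 by rewrite gerBl sqr_ge0.
    have q0 : 0 <= 1 - T k.+1 ^+ 2 by rewrite subr_ge0 expr_le1// ltW.
    by rewrite mulrAC ler_piMl ?(ltW (T0 k))// mulr_ile1// ltW.
  have half1 : `|1 / 2 : R| < 1 by rewrite ger0_norm; lra.
  apply: (squeeze_cvgr _ (cvg_cst 0) (cvg_geometric (T 0) half1)).
  by apply: nearW => k; apply/andP; split; [exact: ltW | exact: T_le].
have x_cvg : x @ \oo --> r.
  have rE : Num.sqrt (r ^+ 2 + (rt * 0) ^+ 2) = r.
    by rewrite mulr0 expr0n addr0 sqrtr_sqr gtr0_norm.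
  rewrite -[X in _ --> X]rE.
  apply: continuous_cvg; first exact: sqrt_continuous.
  apply: cvgD; first exact: cvg_cst.
  by apply: (cvg_sqr); apply: cvgM => //; exact: cvg_cst.
have x_gt k : r < x k.
  rewrite -[ltLHS](ger0_norm (ltW r0)) -sqrtr_sqr ltr_sqrt ?ltrDl ?exprn_gt0 ?mulr_gt0//.
  by rewrite addr_gt0 ?exprn_gt0 ?mulr_gt0.
(* Multiplying by the conjugate [x k + r] exposes the quadratic dependence on [T k], the source of
   the squared rate. *)
have x_sub k : x k - r = (rt * T k) ^+ 2 / (x k + r).
  have xr : x k + r != 0 by rewrite gt_eqF// addr_gt0// (lt_trans r0).
  apply: (mulIf xr); rewrite divfK// -subr_sqr sqr_sqrtr ?addr_ge0 ?sqr_ge0//.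
  by rewrite addrC addKr.
split=> //.
- have : mu ^+ 2 <= 1 by rewrite expr_le1// ltW.
  have : 0 < mu ^+ 2 by rewrite exprn_gt0.
  by move=> *; apply/andP; split; lra.
- by move=> k; rewrite gt_eqF.
(* Only the numerator [T_{k+1}] is expanded by the recurrence, so [rt] and [T_k] cancel and no
   quotient of vanishing quantities remains. *)
have -> : (fun k => `|x k.+1 - r| / `|x k - r|)
  = (fun k => (mu * (1 - T k.+1 ^+ 2) / 2) ^+ 2 * ((x k + r) / (x k.+1 + r))).
  apply/funext => k; rewrite !gtr0_norm ?subr_gt0// !x_sub {1}TS.
  have x1 : x k + r != 0 by rewrite gt_eqF// addr_gt0// (lt_trans r0).
  have x2 : x k.+1 + r != 0 by rewrite gt_eqF// addr_gt0// (lt_trans r0).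
  by field; rewrite x1 x2 !gt_eqF.
have TS0 : T k.+1 @[k --> \oo] --> 0 by rewrite -(cvg_shiftS T) in T_cvg0.
have xS : x k.+1 @[k --> \oo] --> r by rewrite -(cvg_shiftS x) in x_cvg.
(* The rate is rewritten as the expression above evaluated at [T = 0] and [x = r], so that the limit
   laws apply factor by factor. *)
have -> : mu ^+ 2 / 4 = (mu * (1 - 0 ^+ 2) / 2) ^+ 2 * ((r + r) / (r + r)).
  by rewrite divff ?gt_eqF ?addr_gt0//; field.
apply: cvgM.
  apply: (cvg_sqr); apply: cvgM; last exact: cvg_cst.
  apply: cvgM; first exact: cvg_cst.
  apply: cvgB; first exact: cvg_cst.
  exact: (cvg_sqr).
apply: cvgM; first by apply: cvgD => //; exact: cvg_cst.
apply: cvgV; first by rewrite gt_eqF// addr_gt0.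
by apply: cvgD => //; exact: cvg_cst.
Qed.

(** * Uhlig's cuts on the disk: angle recurrence and rate *)

Theorem theorem4p9 (R : realType) (n : nat) (hn : (2 <= n)%N)
  (K : 'M[R[i]]_n) (hK : field_of_values K = [set z : R[i] | `|z| <= 1])
  (s rt : R) (hs : 0 <= s) (hrt : 0 < rt)
  (M : 'M[R[i]]_n) (hM : M = (s%:C)%:M + rt%:C *: K)
  (r mu : R) (hr : r = s + rt) (hmu : mu = rt / r)
  (j : nat) (theta phi : nat -> R) (b c : nat -> R[i])
  (hcuts : uhlig_clockwise_cuts M s rt j theta phi b c) :
  (forall k : nat, (j <= k)%N -> phi k.+1 = atan (mu * tan (phi k / 2))) /\
  Qlinear_cvg (fun k : nat => normc (c (j + k)%N)) r (mu ^+ 2 / 4).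
Proof.
have r0 : 0 < r by rewrite hr ltr_wpDl.
have mu01 : 0 < mu <= 1.
  by rewrite hmu divr_gt0// ler_pdivrMr// mul1r hr lerDr.
have /andP[mu0 _] := mu01.
case: hcuts => _ phij corner cut_angle cut_point next_angle.
have p0 := pi_gt0 R.
have cE k : (j <= k)%N -> 0 < phi k < pi -> c k = r +i* (rt * tan (phi k / 2)).
  move=> jk phik; rewrite hr; apply: (corner_disk K M s rt hK (ltW hrt) hM _ _ phik).
  by rewrite corner.
have tan_gt0 k : 0 < phi k < pi -> 0 < tan (phi k / 2).
  by move=> phik; rewrite -[ltLHS]tan0 ltr_tan ?in_itv/=; lra.
(* The recurrence is first proved conditionally on [0 < phi k < pi], so that the induction
   establishing this range can use it. *)
have step k : (j <= k)%N -> 0 < phi k < pi ->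
    phi k.+1 = atan (mu * tan (phi k / 2)).
  move=> jk phik; set a := atan _.
  have a0 : 0 < a by rewrite -[ltLHS]atan0 lt_atan// mulr_gt0// tan_gt0.
  (* The corner has slope [rt T_k / r = mu T_k] as seen from the origin, whereas [phi] is measured
     from the center [s]; the tangency point carries the cutting angle over to [phi k.+1]. *)
  have thetaE : theta k.+1 = - a.
    rewrite cut_angle// cE// Arg_right//; last by rewrite mulr_ge0 ?ltW ?tan_gt0.
    by rewrite mulrAC -hmu.
  have bE : b k.+1 = s%:C + rt%:C * expi a.
    rewrite -(opprK a) -thetaE; apply: (support_point_disk K M s rt hK (ltW hrt) hM).
    by rewrite cut_point.
  rewrite next_angle// bE addrC addKr Arg_polar//.
  by have := atan_ltpi2 (mu * tan (phi k / 2)); rewrite -/a; lra.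
have phi_in k : 0 < phi (j + k)%N < pi.
  elim: k => [|k IHk]; first by rewrite addn0.
  rewrite addnS step ?leq_addr// -[ltLHS]atan0 lt_atan ?(mulr_gt0 mu0 (tan_gt0 _ IHk))//=.
  by have := atan_ltpi2 (mu * tan (phi (j + k)%N / 2)); lra.
split=> [k jk|]; first by rewrite step// -(subnKC jk) phi_in.
have -> : (fun k => normc (c (j + k)%N))
  = (fun k => Num.sqrt (r ^+ 2 + (rt * tan (phi (j + k)%N / 2)) ^+ 2)).
  by apply/funext => k; rewrite cE ?leq_addr.
(* Applied to [x = mu T_k], whose arctangent is the next angle, this supplies both the bound and the
   implicit recurrence for [T_{k+1}]. *)
have half k := tan_half_atan _ (mulr_gt0 mu0 (tan_gt0 _ (phi_in k))).
apply: Qlinear_cvg_hypot => // k; first exact: tan_gt0.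
- by rewrite addnS step ?leq_addr//; have [/andP[]] := half k.
- by rewrite addnS step ?leq_addr//; have [] := half k.
Qed.
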